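(* Consider $n$ agents indexed by $\mathcal{V}=\{1,\dots,n\}$ communicating over a time-varying directed graph $\mathcal{G}(\mathcal{A}(t))$ with nonnegative weights $a_{ij}(t)$, where $a_{ij}(t)>0$ if and only if $j\in N_i(t)$ (agent $i$ receives information from agent $j$ at time $t$). Assume: (i) the CFP solution set $\mathbf{X}^*$ is non-empty; (ii) the graph is balanced, i.e. $\sum_{j=1}^n a_{ij}(t)=\sum_{j=1}^n a_{ji}(t)$ for all $i$ and all $t\ge0$; (iii) the $\delta$-graph $\mathcal{G}_{(\delta,T)}$ is strongly connected. Let each agent have state $x_i(t)\in\mathbb{R}^m$ evolving according to $$\dot x_i(t)=\sum_{j\in N_i(t)} a_{ij}(t)\big(x_j(t)-x_i(t)\big)+\phi_i(t),\qquad \phi_i(t)=-\tau\Big(\big[x_i(t)-P_{X_i}(x_i(t))\big]+\nabla g_i^+(x_i(t))\Big),$$ with $\tau>0$. If $\lim_{t\to\infty}\phi_i(t)=0$ for every $i\in\mathcal{V}$, then the agents reach consensus asymptotically and there is a point $x^*\in\mathbf{X}^*$ with $\lim_{t\to\infty}x_i(t)=x^*$ for every $i$.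
   Context: For each $i$, $g_i:\mathbb{R}^m\to\mathbb{R}$ is convex and continuous, $X_i\subset\mathbb{R}^m$ is closed and convex, $X=\bigcap_i X_i$. The CFP asks for $x$ with $g_i(x)\le0$ for all $i$ and $x\in X$; $\mathbf{X}^*$ is its solution set. $g_i^+(x)=\max[g_i(x),0]$; $P_{X_i}$ is the Euclidean projection onto $X_i$; $\nabla g_i^+(x)$ is a subgradient of $g_i^+$ at $x$, chosen as $0$ if $g_i(x)\le0$ and as a subgradient of $g_i$ at $x$ otherwise, assumed piecewise continuous in $x$. For positive constants $T,\delta$, the $\delta$-graph is $\mathcal{G}_{(\delta,T)}=(\mathcal{V},\mathcal{E}_{(\delta,T)})$ with $\mathcal{E}_{(\delta,T)}=\{(j,i): \int_t^{t+T}a_{ij}(s)\,ds\ge\delta \text{ for all } t\ge0\}$; assumption (iii) means there exist $T,\delta>0$ for which this directed graph is strongly connected. Consensus means $\lim_{t\to\infty}\|x_i(t)-x_j(t)\|=0$ for all $i,j$. *)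

(* Defs.v *)
From HB Require Import structures.
From mathcomp Require Import all_boot all_order all_algebra.
From mathcomp Require Import all_classical all_reals all_analysis.
From Stdlib Require Import Relations.
Set Implicit Arguments. Unset Strict Implicit. Unset Printing Implicit Defensive.
Import Order.TTheory GRing.Theory Num.Theory.
Import numFieldNormedType.Exports.
Local Open Scope classical_set_scope.
Local Open Scope ring_scope.

Section Defs.
Variables (R : realType) (m : nat).
Implicit Types (u v x y : 'rV[R]_m).

Definition dotv u v : R := \sum_(k < m) u ord0 k * v ord0 k.
Definition enorm2 v : R := dotv v v.

Definition convex_setR (C : set 'rV[R]_m) : Prop :=
  forall x y (l : R), C x -> C y -> 0 <= l <= 1 -> C (l *: x + (1 - l) *: y).

Definition convex_fun (g : 'rV[R]_m -> R) : Prop :=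
  forall x y (l : R), 0 <= l <= 1 ->
    g (l *: x + (1 - l) *: y) <= l * g x + (1 - l) * g y.

Definition is_proj (C : set 'rV[R]_m) x p : Prop :=
  C p /\ forall y, C y -> enorm2 (x - p) <= enorm2 (x - y).

Definition is_subgradient (g : 'rV[R]_m -> R) x v : Prop :=
  forall y, g x + dotv v (y - x) <= g y.

Definition is_grad_plus (g : 'rV[R]_m -> R) (G : 'rV[R]_m -> 'rV[R]_m) : Prop :=
  forall x, (g x <= 0 -> G x = 0) /\ (0 < g x -> is_subgradient g x (G x)).

Definition cfp_sol (n : nat) (g : 'I_n -> 'rV[R]_m -> R)
  (X : 'I_n -> set 'rV[R]_m) : set 'rV[R]_m :=
  [set x | forall i, g i x <= 0 /\ X i x].
End Defs.

Section Graph.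
Variables (R : realType) (n : nat).

Definition delta_edge (a : 'I_n -> 'I_n -> R -> R) (delta T : R)
  (j i : 'I_n) : Prop :=
  forall t : R, 0 <= t ->
    delta <= Rintegral (@lebesgue_measure R) `[t, t + T] (a i j).

Definition strongly_connected (E : 'I_n -> 'I_n -> Prop) : Prop :=
  forall i j : 'I_n, clos_refl_trans 'I_n E i j.

Definition balanced (a : 'I_n -> 'I_n -> R -> R) : Prop :=
  forall (i : 'I_n) (t : R), 0 <= t ->
    \sum_(j < n) a i j t = \sum_(j < n) a j i t.
End Graph.

(* Main.v *)
(** Let V be the sum of the squared distances of the agents to a solution z.
Balance of the graph and the obtuse-angle inequality for projections give
-V' >= W := sum_ij a_ij |x_j - x_i|^2 >= 0, so trajectories are bounded and
the integral of -V' over [t, t + T] tends to 0.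

For consensus, fix a coordinate and let h be any function with Lipschitz
derivative. By balance, sum_i h(x_i) has derivative O(W) + O(max |phi_i|), with
no bound on the weights a_ij, so it is almost constant on windows of length T:
the empirical distribution of the agents hardly moves. If the spread of the
agents were not small at time t, pigeonhole would give a gap in their positions;
taking for h a bump supported in the gap, no agent can enter the middle of
the gap during [t, t + T]. Some delta-edge crosses the gap, and it forces the
integral of W over the window to be bounded below: a contradiction.

Finally phi_i -> 0 forces |x_i - P_i x_i|^2 + g_i^+(x_i) -> 0, so a cluster
point of the trajectory is a solution; V centred at this point is nonincreasing
and has 0 as a cluster value, hence tends to 0.

Neither the weights a_ij nor the phi_i are assumed measurable, so only the
integrals of the total right-hand sides (and of -V') are manipulated. *)

Require Import Defs.
From HB Require Import structures.
From mathcomp Require Import all_boot all_order all_algebra.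
From mathcomp Require Import all_classical all_reals all_analysis.
From mathcomp Require Import measurable_realfun ring lra.
From Stdlib Require Import Relations.
Import Order.TTheory GRing.Theory Num.Theory.
Import numFieldNormedType.Exports.
Local Open Scope classical_set_scope.
Local Open Scope ring_scope.

Set Implicit Arguments. Unset Strict Implicit. Unset Printing Implicit Defensive.

(** * Indefinite integrals and the chain rule *)

(* Halving: Phi takes its mean value at some point of [s, t], so C improves to
   C / 2 and, iterating, to C / 2 ^ k. *)
Lemma const_of_quadratic_increments (R : realType) (F Phi : R -> R) (C a b : R) :
  a <= b -> {within `[a, b], continuous Phi} ->
  (forall s t, a <= s -> s <= t -> t <= b ->
     `|F t - F s| <= C * (Phi t - Phi s) ^+ 2) ->
  F b = F a.
Proof.
move=> ab cPhi H.
have K k : forall s t, a <= s -> s <= t -> t <= b ->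
    2 ^+ k * `|F t - F s| <= C * (Phi t - Phi s) ^+ 2.
  elim: k => [|k IH] s t sa st tb; first by rewrite expr0 mul1r; exact: H.
  have cst : {within `[s, t], continuous Phi}.
    apply: continuous_subspaceW cPhi => z /=; rewrite !in_itv/=.
    by move=> /andP[? ?]; apply/andP; split; [exact: le_trans sa _|exact: le_trans tb].
  have [|u] := @IVT R Phi s t ((Phi s + Phi t) / 2) st cst.
    by rewrite ge_min le_max; case: (leP (Phi s) (Phi t)) => ?; apply/andP; split;
      apply/orP; (do [by left; lra | by right; lra]).
  rewrite in_itv/= => /andP[su ut] Phiu.
  have h1 := IH s u sa su (le_trans ut tb).
  have h2 := IH u t (le_trans sa su) ut tb.
  rewrite Phiu in h1 h2.
  have h3 : `|F t - F s| <= `|F t - F u| + `|F u - F s|.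
    by rewrite (_ : F t - F s = (F t - F u) + (F u - F s)) ?ler_normD//; ring.
  have h4 : 2 ^+ k * `|F t - F s| <= 2 ^+ k * (`|F t - F u| + `|F u - F s|).
    by rewrite ler_pM2l ?exprn_gt0.
  have h5 : C * ((Phi s + Phi t) / 2 - Phi s) ^+ 2 =
    C * (Phi t - Phi s) ^+ 2 / 4 by field.
  have h6 : C * (Phi t - (Phi s + Phi t) / 2) ^+ 2 =
    C * (Phi t - Phi s) ^+ 2 / 4 by field.
  rewrite h5 in h1; rewrite h6 in h2; rewrite mulrDr in h4; rewrite exprS -mulrA.
  lra.
(* As [k <= 2 ^ k], any [k] above [M / e] makes the increment at most [e]. *)
apply/eqP; rewrite -subr_eq0 -normr_le0; apply/ler_addgt0Pl => e e0; rewrite addr0.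
pose M := C * (Phi b - Phi a) ^+ 2.
have [k Hk] : exists k : nat, M / e < k%:R.
  exists (Num.bound (M / e)); apply: archi_boundP.
  apply: divr_ge0 (ltW e0); apply: le_trans (H a b (lexx _) ab (lexx _)).
  exact: normr_ge0.
have := K k a b (lexx _) ab (lexx _); rewrite -/M.
have kp : k%:R <= (2 : R) ^+ k by rewrite -natrX ler_nat ltnW// ltn_expl.
move: Hk; rewrite ltr_pdivrMr// => Hk KM.
have : (2 : R) ^+ k * `|F b - F a| <= 2 ^+ k * e.
  by apply: le_trans KM _; apply: (le_trans (ltW Hk)); rewrite ler_pM2r.
by rewrite ler_pM2l// exprn_gt0.
Qed.

(* [y] is absolutely continuous on [0, +oo) with almost-everywhere derivative [f]. *)
Definition AC (R : realType) (y f : R -> R) : Prop := forall t : R, 0 <= t ->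
  (@lebesgue_measure R).-integrable `[0, t] (EFin \o f) /\
  y t = y 0 + \int[@lebesgue_measure R]_(s in `[0, t]) f s.

Section AC_theory.
Context {R : realType}.
Notation mu := (@lebesgue_measure R).
Implicit Types y f z g h dh : R -> R.

Lemma AC_integrable y f (s t : R) : AC y f -> 0 <= s ->
  mu.-integrable `[s, t] (EFin \o f).
Proof.
move=> yf s0; have [st|ts] := leP s t; last first.
  by rewrite set_itv_ge ?bnd_simp -?ltNge//; exact: integrable_set0.
have [fi _] := yf t (le_trans s0 st).
by apply: integrableS fi => //; apply: subset_itvr; rewrite bnd_simp.
Qed.

Lemma AC_increment y f (s t : R) : AC y f -> 0 <= s -> s <= t ->
  y t - y s = \int[mu]_(r in `[s, t]) f r.
Proof.
move=> yf s0 st; have [fi ->] := yf t (le_trans s0 st).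
have [_ ->] := yf s s0.
rewrite -[RHS](@Rintegral_itv_obnd_cbnd _ s); last first.
  apply: integrableS (AC_integrable t yf s0) => //.
  by apply: subset_itvr; rewrite bnd_simp.
rewrite -(Rintegral_itvB fi) ?bnd_simp//; ring.
Qed.

Lemma AC_continuous y f (t : R) : AC y f -> 0 <= t -> {within `[0, t], continuous y}.
Proof.
move=> yf t0.
have H := parameterized_integral_continuous t0 (AC_integrable t yf (lexx 0)).
apply: (@subspace_eq_continuous _ `[0, t]%classic _
  ((fun x => y 0 + \int[mu]_(s in `[0, x]) f s) : subspace `[0, t] -> R)).
  move=> x; rewrite inE/= in_itv/= => /andP[x0 _].
  by have [_ yE] := yf x x0; exact: esym yE.
by move=> x; apply: cvgD; [exact: cvg_cst|exact: H].
Qed.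

Lemma AC_le y f z g (s t : R) : AC y f -> AC z g -> 0 <= s -> s <= t ->
  (forall r, s <= r -> r <= t -> f r <= g r) -> y t - y s <= z t - z s.
Proof.
move=> yf zg s0 st fg; rewrite (AC_increment yf)// (AC_increment zg)//.
apply: le_Rintegral => //;
  [exact: (AC_integrable t yf s0)|exact: (AC_integrable t zg s0)|].
by move=> r /=; rewrite in_itv/= => /andP[]; exact: fg.
Qed.

Lemma AC_ge0 y f (s t : R) : AC y f -> 0 <= s -> s <= t ->
  (forall r, s <= r -> r <= t -> 0 <= f r) -> y s <= y t.
Proof.
move=> yf s0 st f0; rewrite -subr_ge0 (AC_increment yf)//.
by apply: Rintegral_ge0 => r /=; rewrite in_itv/= => /andP[]; exact: f0.
Qed.

Import HBNNSimple.

(* [f] need not be measurable; its integral is then the lower integral. *)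
Lemma AC_Rintegral_le f z g (s t : R) : AC z g -> 0 <= s -> s <= t ->
  (forall r, s <= r -> r <= t -> 0 <= f r <= g r) ->
  \int[mu]_(r in `[s, t]) f r <= z t - z s.
Proof.
move=> zg s0 st fg; rewrite (AC_increment zg)//.
have gi := AC_integrable t zg s0.
have f0 r : `[s, t]%classic r -> (0 <= (f r)%:E)%E.
  by rewrite /= in_itv/= => /andP[sr rt]; rewrite lee_fin; case/andP: (fg r sr rt).
have g0 r : `[s, t]%classic r -> (0 <= (g r)%:E)%E.
  rewrite /= in_itv/= => /andP[sr rt]; rewrite lee_fin.
  by case/andP: (fg r sr rt); exact: le_trans.
(* Both integrals are suprema over simple functions below the integrand, so they compare without
   measurability of [f]. *)
have le : (\int[mu]_(r in `[s, t]) (f r)%:E <= \int[mu]_(r in `[s, t]) (g r)%:E)%E.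
  rewrite !ge0_integralE//; apply: le_ereal_sup => _ [k /= kf <-]; exists k => // x.
  apply: le_trans (kf x) _; rewrite /patch; case: ifPn => // /set_mem /=.
  by rewrite in_itv/= => /andP[sx xt]; rewrite lee_fin; case/andP: (fg x sx xt).
have gfin : (\int[mu]_(r in `[s, t]) (g r)%:E \is a fin_num)%E.
  exact: integrable_fin_num gi.
apply: fine_le => //.
rewrite ge0_fin_numE ?integral_ge0//; apply: le_lt_trans le _.
by rewrite -ge0_fin_numE ?integral_ge0.
Qed.

Lemma AC_cst (c : R) : AC (fun=> c) (fun=> 0).
Proof.
move=> t t0; split; first exact: integrable0.
by rewrite Rintegral_cst// mul0r addr0.
Qed.

Lemma AC_lin (c : R) : AC (fun t => c * t) (fun=> c).
Proof.
move=> t t0; split.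
  apply: continuous_compact_integrable; first exact: segment_compact.
  by apply: continuous_subspaceT => ?; exact: cst_continuous.
have -> : \int[mu]_(_ in `[0, t]) c = c * fine (mu `[0, t]%classic).
  exact: Rintegral_cst.
rewrite lebesgue_measure_itv/= lte_fin mulr0 add0r.
by case: ltP => [_|t0']; [rewrite /= oppr0 addr0
  |rewrite (_ : t = 0)//; apply/eqP; rewrite eq_le t0' t0].
Qed.

Lemma AC_add y f z g : AC y f -> AC z g ->
  AC (fun t => y t + z t) (fun t => f t + g t).
Proof.
move=> yf zg t t0; have [fi yE] := yf t t0; have [gi zE] := zg t t0; split.
  exact: (integrableD _ fi gi).
rewrite RintegralD// yE zE; ring.
Qed.

Lemma AC_scale c y f : AC y f -> AC (fun t => c * y t) (fun t => c * f t).
Proof.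
move=> yf t t0; have [fi yE] := yf t t0; split.
  by have := @integrableZl _ _ _ mu `[0, t]%classic _ c _ fi; apply.
by rewrite RintegralZl// yE mulrDr.
Qed.

Lemma AC_sum (I : finType) (y f : I -> R -> R) : (forall i, AC (y i) (f i)) ->
  AC (fun t => \sum_i y i t) (fun t => \sum_i f i t).
Proof.
move=> yf; elim: (index_enum I) => [|i r IH].
  have E (w : I -> R -> R) : (fun t => \sum_(i <- [::]) w i t) = fun=> 0.
    by apply/funext => t; rewrite big_nil.
  by rewrite !E; exact: AC_cst.
have E (w : I -> R -> R) :
    (fun t => \sum_(j <- i :: r) w j t) = fun t => w i t + \sum_(j <- r) w j t.
  by apply/funext => t; rewrite big_cons.
by rewrite !E; exact: AC_add.
Qed.

Lemma AC_Rintegral f : (forall t, 0 <= t -> mu.-integrable `[0, t] (EFin \o f)) ->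
  AC (fun t => \int[mu]_(s in `[0, t]) f s) f.
Proof.
by move=> fi t t0; split; [exact: fi|rewrite set_itv1 Rintegral_set1 add0r].
Qed.

Lemma AC_norm_le y f z g (s t : R) : AC y f -> AC z g -> 0 <= s -> s <= t ->
  (forall r, s <= r -> r <= t -> `|f r| <= g r) -> `|y t - y s| <= z t - z s.
Proof.
move=> yf zg s0 st fg; rewrite ler_norml; apply/andP; split.
  have fg' r : s <= r -> r <= t -> -1 * f r <= g r.
    by move=> sr rt; have := fg r sr rt; rewrite ler_norml => /andP[? ?]; lra.
  have := AC_le (AC_scale (-1) yf) zg s0 st fg'; lra.
by apply: AC_le yf zg s0 st _ => r sr rt; apply: le_trans (fg r sr rt); exact: ler_norm.
Qed.

(** The hypothesis says that [h] has the Lipschitz derivative [dh]. In this quadratic-remainder form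
    it gives the chain rule with no appeal to almost-everywhere differentiation. *)
Lemma AC_comp h dh L y f :
  (forall u v, `|h v - h u - dh u * (v - u)| <= L * (v - u) ^+ 2) ->
  AC y f -> AC (h \o y) (fun t => dh (y t) * f t).
Proof.
move=> hL yf.
have L0 : 0 <= L by have := le_trans (normr_ge0 _) (hL 0 1); rewrite subr0 expr1n mulr1.
(* Adding the remainder bounds for [(u, v)] and [(v, u)] leaves only the difference of the
   derivatives. *)
have dhL u v : `|dh v - dh u| <= 2 * L * `|v - u|.
  have [->|uv] := eqVneq u v; first by rewrite !subrr normr0 mulr0.
  have d0 : 0 < `|v - u| by rewrite normr_gt0 subr_eq0 eq_sym.
  rewrite -(ler_pM2r d0) -normrM.
  rewrite (_ : 2 * L * _ * _ = 2 * L * (v - u) ^+ 2); last first.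
    by rewrite -[in RHS]real_normK ?num_real//; ring.
  have h1 := hL u v; have h2 := hL v u.
  have -> : (dh v - dh u) * (v - u) =
    (h v - h u - dh u * (v - u)) + (h u - h v - dh v * (u - v)) by ring.
  apply: le_trans (ler_normD _ _) _.
  have : (u - v) ^+ 2 = (v - u) ^+ 2 by ring.
  move=> e; rewrite e in h2; lra.
have cdh : continuous dh.
  move=> u; apply/cvgrPdist_le => e e0; near=> v.
  rewrite distrC; apply: le_trans (dhL u v) _.
  have : `|v - u| <= e / (2 * L + 1).
    rewrite distrC; near: v.
    apply: (@cvgr_dist_le _ _ _ (nbhs u) _ id u); first exact: cvg_id.
    by rewrite divr_gt0//; lra.
  by rewrite ler_pdivlMr; [move=> ?; have := normr_ge0 (v - u); nra|lra].
have fi t : 0 <= t -> mu.-integrable `[0, t] (EFin \o f) by move=> /yf[].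
pose Phi t := \int[mu]_(s in `[0, t]) `|f s|.
have PhiAC : AC Phi (fun s => `|f s|).
  by apply: AC_Rintegral => t t0; exact: (integrable_norm (fi t t0)).
have yPhi s t : 0 <= s -> s <= t -> `|y t - y s| <= Phi t - Phi s.
  by move=> s0 st; apply: (AC_norm_le yf PhiAC).
have Phinc s t : 0 <= s -> s <= t -> Phi s <= Phi t.
  by move=> s0 st; apply: (AC_ge0 PhiAC).
pose G t := \int[mu]_(s in `[0, t]) (dh (y s) * f s).
have GAC : AC G (fun t => dh (y t) * f t).
  apply: AC_Rintegral => t t0.
  have := @integrableMr _ _ _ mu `[0, t]%classic _ (dh \o y) (EFin \o f).
  apply => //; last exact: fi.
    apply: subspace_continuous_measurable_fun => //.
    have cy := AC_continuous yf t0; move=> r.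
    exact: (@continuous_comp (subspace `[0, t]) R R y dh r (cy r) (cdh _)).
  exists (`|dh (y 0)| + 2 * L * Phi t); split; first exact: num_real.
  move=> M hM r /=; rewrite in_itv/= => /andP[r0 rt].
  apply: le_trans (ltW hM).
  have h1 := dhL (y 0) (y r); have h2 := yPhi 0 r (lexx _) r0.
  have h3 := Phinc r t r0 rt.
  have h4 : Phi 0 = 0 by rewrite /Phi set_itv1 Rintegral_set1.
  have h5 : `|dh (y r)| <= `|dh (y 0)| + `|dh (y r) - dh (y 0)|.
    by rewrite -{1}(subrKC (dh (y 0)) (dh (y r))) ler_normD.
  have h6 : 2 * L * `|y r - y 0| <= 2 * L * Phi t by rewrite ler_wpM2l//; lra.
  lra.
move=> t t0; split; first by have [] := GAC t t0.
pose F r := h (y r) - G r.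
(* Both dh \o y and y vary by O(Phi u - Phi s) on [s, u], hence F by its square. *)
suff : F t = F 0.
  by rewrite /F {2}/G set_itv1 Rintegral_set1 subr0 /= => <-; rewrite -/(G t); ring.
apply: (@const_of_quadratic_increments _ _ Phi (3 * L) 0 t t0 (AC_continuous PhiAC t0)).
move=> s u s0 su ut.
(* This function has derivative [(dh (y r) - dh (y s)) * f r]. It contributes [2 * L] and the Taylor
   remainder [L], whence [3 * L]. *)
have lin := AC_add GAC (AC_scale (- dh (y s)) yf).
have c0 := AC_scale (2 * L * (Phi u - Phi s)) PhiAC.
have h1 := AC_norm_le lin c0 s0 su.
have {}h1 := h1 _.
have h2 := hL (y s) (y u).
have h3 : L * (y u - y s) ^+ 2 <= L * (Phi u - Phi s) ^+ 2.
  rewrite ler_wpM2l// -[leLHS]ger0_norm ?sqr_ge0// normrX lerXn2r ?nnegrE ?subr_ge0//.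
    exact: Phinc.
  exact: yPhi.
have {}h1 : `|(G u - G s) - dh (y s) * (y u - y s)| <= 2 * L * (Phi u - Phi s) ^+ 2.
  rewrite (_ : G u - G s - _ =
    G u + - dh (y s) * y u - (G s + - dh (y s) * y s)); last by ring.
  rewrite (_ : 2 * _ * _ ^+ 2 =
    2 * L * (Phi u - Phi s) * Phi u - 2 * L * (Phi u - Phi s) * Phi s); last by ring.
  apply: h1 => r sr ru.
  rewrite (_ : _ + _ = (dh (y r) - dh (y s)) * f r); last by ring.
  rewrite normrM ler_wpM2r//; apply: le_trans (dhL _ _) _.
  rewrite ler_wpM2l ?mulr_ge0//; apply: le_trans (yPhi _ _ s0 sr) _.
  by rewrite lerB// Phinc// (le_trans s0 sr).
rewrite (_ : F u - F s = (h (y u) - h (y s) - dh (y s) * (y u - y s))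
  - ((G u - G s) - dh (y s) * (y u - y s))); last by rewrite /F; ring.
apply: le_trans (ler_normB _ _) _; lra.
Unshelve. all: by end_near. Qed.

End AC_theory.

(** * Consensus in one coordinate *)

Section Balanced.
Context {R : realType} {n : nat}.
Variable w : 'I_n -> 'I_n -> R.
Hypothesis w_bal : forall i, \sum_j w i j = \sum_j w j i.

(** Summing by columns and then using balance turns the terms in [th j] into those in [th i]. *)
Lemma balanced_sum_diff (th : 'I_n -> R) :
  \sum_i \sum_j w i j * (th j - th i) = 0.
Proof.
under eq_bigr do under eq_bigr do rewrite mulrBr.
under eq_bigr do rewrite sumrB -mulr_suml.
rewrite sumrB exchange_big/=.
under eq_bigr do rewrite -mulr_suml -w_bal.
by rewrite subrr.
Qed.

(** Since [2 * y i * (y j - y i) = y j ^+ 2 - y i ^+ 2 - (y j - y i) ^+ 2], the differences of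
    squares cancel by balance. *)
Lemma balanced_dissipation (y : 'I_n -> R) :
  \sum_i 2 * y i * \sum_j w i j * (y j - y i) =
  - \sum_i \sum_j w i j * (y j - y i) ^+ 2.
Proof.
rewrite -[LHS]subr0 -[X in _ - X = _](balanced_sum_diff (fun i => y i ^+ 2)).
rewrite -sumrB -sumrN.
apply: eq_bigr => i _; rewrite mulr_sumr -sumrB -sumrN.
by apply: eq_bigr => j _; ring.
Qed.

Hypothesis w_ge0 : forall i j, 0 <= w i j.

(** The differences [h (y j) - h (y i)] cancel by balance; only the quadratic remainders survive, so
    no bound on the weights enters. *)
Lemma balanced_drift_le (h dh : R -> R) L (y : 'I_n -> R) :
  (forall u v, `|h v - h u - dh u * (v - u)| <= L * (v - u) ^+ 2) ->
  `|\sum_i dh (y i) * \sum_j w i j * (y j - y i)| <=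
  L * \sum_i \sum_j w i j * (y j - y i) ^+ 2.
Proof.
move=> hL; rewrite -[X in `|X|]subr0 -[X in `|_ - X|](balanced_sum_diff (h \o y)).
rewrite -sumrB mulr_sumr.
apply: le_trans (ler_norm_sum _ _ _) _; apply: ler_sum => i _.
rewrite mulr_sumr -sumrB mulr_sumr.
apply: le_trans (ler_norm_sum _ _ _) _; apply: ler_sum => j _.
rewrite (_ : _ - _ =
  - (w i j * (h (y j) - h (y i) - dh (y i) * (y j - y i)))) /=; last by ring.
by rewrite normrN normrM ger0_norm// mulrCA ler_wpM2l.
Qed.

End Balanced.

(** * The bump function *)

Section Bspline.
Context {R : realType}.

Definition pospart (u : R) : R := Num.max 0 u.

(* The quadratic B-spline with knots 0, h, 2h, 3h, up to scaling. *)
Definition bspline (h u : R) : R :=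
  pospart u ^+ 2 - 3 * pospart (u - h) ^+ 2 +
  3 * pospart (u - 2 * h) ^+ 2 - pospart (u - 3 * h) ^+ 2.

Definition dbspline (h u : R) : R :=
  2 * pospart u - 6 * pospart (u - h) +
  6 * pospart (u - 2 * h) - 2 * pospart (u - 3 * h).

Lemma sqr_pospart_quad (u v : R) :
  `|pospart v ^+ 2 - pospart u ^+ 2 - 2 * pospart u * (v - u)| <= (v - u) ^+ 2.
Proof.
have := sqr_ge0 u; have := sqr_ge0 v; have := sqr_ge0 (v - u).
rewrite ler_norml /pospart; case: (leP 0 u) => u0; case: (leP 0 v) => v0.
- by move=> *; apply/andP; split; nra.
- by have := mulr_ge0_le0 u0 (ltW v0); move=> *; apply/andP; split; nra.
- by have := mulr_ge0_le0 v0 (ltW u0); move=> *; apply/andP; split; nra.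
- by move=> *; apply/andP; split; nra.
Qed.

(** The constant is [1 + 3 + 3 + 1], from the four truncated squares. *)
Lemma bspline_quad (h u v : R) :
  `|bspline h v - bspline h u - dbspline h u * (v - u)| <= 8 * (v - u) ^+ 2.
Proof.
have H k : `|pospart (v - k) ^+ 2 - pospart (u - k) ^+ 2
    - 2 * pospart (u - k) * (v - u)| <= (v - u) ^+ 2.
  have := sqr_pospart_quad (u - k) (v - k).
  by rewrite (_ : v - k - (u - k) = v - u)//; ring.
have := H 0; have := H h; have := H (2 * h); have := H (3 * h).
rewrite !subr0 /bspline /dbspline !ler_norml.
move=> /andP[? ?] /andP[? ?] /andP[? ?] /andP[? ?]; apply/andP; split; lra.
Qed.

(** The derivative is piecewise linear, with values [0, 2 * h, - 2 * h, 0] at the knots. *)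
Lemma dbspline_le (h u : R) : 0 < h -> `|dbspline h u| <= 2 * h.
Proof.
move=> h0; rewrite ler_norml /dbspline /pospart.
by case: (leP 0 u) => ?; case: (leP 0 (u - h)) => ?; case: (leP 0 (u - 2 * h)) => ?;
  case: (leP 0 (u - 3 * h)) => ?; apply/andP; split; lra.
Qed.

Lemma bspline_ge0 (h u : R) : 0 < h -> 0 <= bspline h u.
Proof.
move=> h0; rewrite /bspline /pospart.
by case: (leP 0 u) => ?; case: (leP 0 (u - h)) => ?; case: (leP 0 (u - 2 * h)) => ?;
  case: (leP 0 (u - 3 * h)) => ?; nra.
Qed.

Lemma bspline_out (h u : R) : 0 < h -> u <= 0 \/ 3 * h <= u -> bspline h u = 0.
Proof.
move=> h0; rewrite /bspline /pospart.
case: (leP 0 u) => ?; case: (leP 0 (u - h)) => ?; case: (leP 0 (u - 2 * h)) => ?;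
  case: (leP 0 (u - 3 * h)) => ? [] ?; try lra; try ring.
by rewrite (_ : u = 0); [ring|lra].
Qed.

Lemma bspline_mid (h u : R) : 0 < h -> h <= u <= 2 * h -> h ^+ 2 <= bspline h u.
Proof.
move=> h0 /andP[hu uh]; rewrite /bspline /pospart.
by case: (leP 0 u) => ?; case: (leP 0 (u - h)) => ?; case: (leP 0 (u - 2 * h)) => ?;
  case: (leP 0 (u - 3 * h)) => ?; nra.
Qed.

End Bspline.

(** Pigeonhole: otherwise each of [n] adjacent open intervals of length [d], starting at [y q],
    holds an agent. Disjointness makes the choice of agents injective, hence surjective, yet [q]
    lies in none of the intervals. *)
Lemma exists_gap (R : realType) (n : nat) (y : 'I_n -> R) (p q : 'I_n) (d : R) :
  0 < d -> y q + n%:R * d <= y p ->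
  exists c, [/\ y q <= c, c + d <= y p & forall i, y i <= c \/ c + d <= y i].
Proof.
move=> d0 qp; apply: contrapT => H.
pose c (k : nat) := y q + k%:R * d.
have K (k : 'I_n) : exists i, c k < y i < c k.+1.
  apply: contrapT => NK; apply: H; exists (c k); split.
  - by rewrite lerDl mulr_ge0// ltW.
  - rewrite /c; apply: le_trans qp; rewrite -addrA lerD2l -{2}(mul1r d) -mulrDl.
    by rewrite ler_pM2r// natr1 ler_nat.
  - move=> i; have [|ci] := leP (y i) (c k); first by left.
    right; rewrite leNgt; apply/negP => ic; apply: NK; exists i; rewrite ci/=.
    apply: lt_le_trans ic _; rewrite /c -natr1; lra.
have [f Hf] := choice K.
have lt_of (k l : 'I_n) : f k = f l -> (k <= l)%N.
  move=> fkl; have /andP[h1 _] := Hf k; have /andP[_ h2] := Hf l.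
  rewrite fkl in h1; have := lt_trans h1 h2.
  by rewrite /c ltrD2l ltr_pM2r// ltr_nat ltnS.
have finj : injective f.
  by move=> k l fkl; apply/val_inj/eqP; rewrite eqn_leq !lt_of.
have [g _ gK] := injF_bij finj.
have /andP[] := Hf (g q); rewrite gK /c.
by have : 0 <= (g q)%:R * d by [rewrite mulr_ge0// ltW]; lra.
Qed.

Lemma crossing_edge (T : Type) (E : T -> T -> Prop) (A : T -> Prop) (p q : T) :
  clos_refl_trans T E p q -> ~ A p -> A q ->
  exists i j, [/\ E i j, ~ A i & A j].
Proof.
elim=> [i j Eij nAi Aj|i nA /nA//|i j k _ IH1 _ IH2 nAi Ak]; first by exists i, j.
by have [Aj|nAj] := pselect (A j); [exact: IH1|exact: IH2].
Qed.

(** Here [h] is a third of the gap width, [eps] bounds the perturbation and [kappa] the increment of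
    [U] over the window. The first smallness condition keeps agents out of the middle third; the
    second contradicts the [delta]-edge across the gap. *)
Lemma window_spread (R : realType) (n : nat) (a : 'I_n -> 'I_n -> R -> R)
    (delta T : R) (y f e : 'I_n -> R -> R) (U W : R -> R)
    (t h eps kappa : R) (p q : 'I_n) :
  balanced a -> (forall i j s, 0 <= s -> 0 <= a i j s) ->
  strongly_connected (delta_edge a delta T) -> 0 <= T -> 0 <= t -> 0 < h ->
  (forall i, AC (y i) (f i)) -> AC U W ->
  (forall i s, 0 <= s ->
     f i s = \sum_j a i j s * (y j s - y i s) + e i s) ->
  (forall s, 0 <= s -> \sum_i \sum_j a i j s * (y j s - y i s) ^+ 2 <= W s) ->
  (forall i s, t <= s -> `|e i s| <= eps) ->
  U (t + T) - U t <= kappa ->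
  8 * kappa + 2 * h * n%:R * eps * T < h ^+ 2 -> kappa < h ^+ 2 * delta ->
  y p t - y q t < n%:R * (3 * h).
Proof.
move=> bal a0 conn T0 t0 h0 yf UW fE DW eE Uk small1 small2.
rewrite ltNge; apply/negP => gap.
have D0 s : 0 <= s -> 0 <= \sum_i \sum_j a i j s * (y j s - y i s) ^+ 2.
  by move=> s0; do 2 apply: sumr_ge0 => ? _; rewrite mulr_ge0 ?a0 ?sqr_ge0.
have W0 s : 0 <= s -> 0 <= W s by move=> s0; apply: le_trans (DW s s0); exact: D0.
have h3 : 0 < 3 * h by lra.
have [|c [qc cp cgap]] := @exists_gap R n (y ^~ t) p q (3 * h) h3; first lra.
(* The bump lives on the gap [[c, c + 3 * h]], whose interior is free of agents at time [t], so its
   sum [B] over the agents starts at 0. *)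
pose th u := bspline h (u - c); pose dth u := dbspline h (u - c).
have thL u v : `|th v - th u - dth u * (v - u)| <= 8 * (v - u) ^+ 2.
  have := bspline_quad h (u - c) (v - c).
  by rewrite (_ : v - c - (u - c) = v - u)//; ring.
have BAC := AC_sum (fun i => AC_comp thL (yf i)).
set B := fun s => \sum_i _ in BAC.
have Bt : B t = 0.
  rewrite /B big1// => i _; rewrite /= /th bspline_out//.
  by case: (cgap i) => ?; [left|right]; lra.
have KAC := AC_add (AC_scale 8 UW) (AC_lin (2 * h * n%:R * eps)).
(* [B] drifts by at most [8 * kappa + 2 * h * n * eps * T] during the window. *)
have Bs s : t <= s -> s <= t + T -> B s < h ^+ 2.
  move=> ts sT; have s0 := le_trans t0 ts.
  have := AC_norm_le BAC KAC t0 ts; rewrite Bt subr0 => H.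
  have Us : U s <= U (t + T).
    by apply: (AC_ge0 UW s0 sT) => r sr _; apply: W0; exact: le_trans sr.
  have eps0 : 0 <= eps by apply: le_trans (eE p t (lexx _)).
  have {}H : `|B s| <= 8 * U s + 2 * h * n%:R * eps * s
      - (8 * U t + 2 * h * n%:R * eps * t).
    apply: H => r tr rs; have r0 := le_trans t0 tr.
    rewrite (_ : \sum_i _ = \sum_i dth (y i r) * (\sum_j a i j r * (y j r - y i r))
        + \sum_i dth (y i r) * e i r); last first.
      by rewrite -big_split; apply: eq_bigr => i _; rewrite fE// mulrDr.
    apply: le_trans (ler_normD _ _) _; apply: lerD.
      apply: le_trans (balanced_drift_le _ _ _ thL) _.
      - by move=> i; exact: bal.
      - by move=> i j; exact: a0.
      - by rewrite ler_wpM2l// DW.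
    apply: le_trans (ler_norm_sum _ _ _) _.
    rewrite (_ : 2 * h * n%:R * eps = \sum_(i < n) 2 * h * eps); last first.
      by rewrite sumr_const card_ord -mulr_natr; ring.
    apply: ler_sum => i _; rewrite normrM ler_pM// ?eE//.
    exact: dbspline_le.
  have : 2 * h * n%:R * eps * (s - t) <= 2 * h * n%:R * eps * T.
    by apply: ler_wpM2l; [rewrite !mulr_ge0// ltW|lra].
  have := ler_norm (B s); lra.
(* One agent in the middle third would already give [B s >= h ^+ 2]. *)
have out i s : t <= s -> s <= t + T -> ~ (c + h <= y i s <= c + 2 * h).
  move=> ts sT /andP[cy yc]; have := Bs s ts sT; rewrite ltNge => /negP; apply.
  rewrite /B (bigD1 i)//= -[leLHS]addr0; apply: lerD.
    by apply: bspline_mid => //; apply/andP; split; lra.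
  by apply: sumr_ge0 => j _; exact: bspline_ge0.
have cont i s : t <= s -> {within `[t, s], continuous (y i)}.
  move=> ts; apply: continuous_subspaceW (AC_continuous (yf i) (le_trans t0 ts)).
  by apply: subset_itvr; rewrite bnd_simp.
(* By continuity an agent leaving its side would pass through the middle third. *)
have low i s : t <= s -> s <= t + T -> y i t <= c -> y i s < c + h.
  move=> ts sT yc; rewrite ltNge; apply/negP => cy.
  have [|r] := @IVT _ (y i) t s (c + h) ts (cont i s ts).
    by rewrite ge_min le_max cy orbT andbT; apply/orP; left; lra.
  rewrite in_itv/= => /andP[tr rs] yr; apply: (out i r tr (le_trans rs sT)).
  by rewrite yr; apply/andP; split; lra.
have high i s : t <= s -> s <= t + T -> c + 3 * h <= y i t -> c + 2 * h < y i s.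
  move=> ts sT yc; rewrite ltNge; apply/negP => cy.
  have [|r] := @IVT _ (y i) t s (c + 2 * h) ts (cont i s ts).
    by rewrite ge_min le_max cy orbT /=; apply/orP; left; lra.
  rewrite in_itv/= => /andP[tr rs] yr; apply: (out i r tr (le_trans rs sT)).
  by rewrite yr; apply/andP; split; lra.
(* [p] starts above the gap and [q] below it, so some [delta]-edge leads from an agent [j] above to
   an agent [i] below. *)
have [|//|j [i [Eji jc ic]]] := @crossing_edge _ _ (fun i => y i t <= c) p q (conn p q).
  by move=> ?; lra.
have {}jc : c + 3 * h <= y j t by case: (cgap j).
have hh : 0 < h ^+ 2 by rewrite exprn_gt0.
have := Eji t t0; apply/negP; rewrite -ltNge.
(* Across this edge the positions differ by more than [h], hence [a i j <= W / h ^+ 2] on the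
   window, with integral at most [kappa / h ^+ 2 < delta]. *)
apply: (@le_lt_trans _ _ ((h ^+ 2)^-1 * U (t + T) - (h ^+ 2)^-1 * U t)).
  apply: (AC_Rintegral_le (AC_scale (h ^+ 2)^-1 UW)) => //; first by rewrite lerDl.
  move=> r tr rT; have r0 := le_trans t0 tr; rewrite a0//=.
  rewrite ler_pdivlMl//; apply: le_trans (DW r r0).
  rewrite (bigD1 i)//= (bigD1 j)//= -addrA -[leLHS]addr0 lerD//.
    rewrite mulrC ler_wpM2l ?a0// lerXn2r ?nnegrE ?ltW//.
      have := low i r tr rT ic; have := high j r tr rT jc; lra.
    have := low i r tr rT ic; have := high j r tr rT jc; lra.
  by rewrite addr_ge0//; repeat (apply: sumr_ge0 => ? _); rewrite mulr_ge0 ?a0 ?sqr_ge0.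
by rewrite -mulrBr ltr_pdivrMl//; apply: le_lt_trans Uk _.
Qed.

(** * Row vectors *)

Section RowVectors.
Context {R : realType} {m : nat}.
Implicit Types (u v x z p : 'rV[R]_m) (C : set 'rV[R]_m).

(** The norm of a row vector is the maximum norm, not the Euclidean one whose square is [enorm2]. *)
Lemma coord_le_norm v (k : 'I_m) : `|v ord0 k| <= `|v|.
Proof.
rewrite [leRHS]/Num.norm /= mx_normrE.
by apply: (@le_bigmax _ _ _ 0 (fun ij : 'I_1 * 'I_m => `|v ij.1 ij.2|) (ord0, k)).
Qed.

Lemma norm_le_coord v (e : R) : 0 <= e ->
  (forall k, `|v ord0 k| <= e) -> `|v| <= e.
Proof.
move=> e0 H; rewrite [leLHS]/Num.norm /= mx_normrE.
by apply: bigmax_le => // -[i k] _ /=; rewrite (ord1 i); exact: H.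
Qed.

Lemma dotvC u v : dotv u v = dotv v u.
Proof. by apply: eq_bigr => k _; rewrite mulrC. Qed.

Lemma dotvDr u v w : dotv u (v + w) = dotv u v + dotv u w.
Proof. by rewrite -big_split; apply: eq_bigr => k _; rewrite mxE mulrDr. Qed.

Lemma dotvZr u (c : R) v : dotv u (c *: v) = c * dotv u v.
Proof. by rewrite /dotv mulr_sumr; apply: eq_bigr => k _; rewrite mxE; ring. Qed.

Lemma dotvBr u v w : dotv u (v - w) = dotv u v - dotv u w.
Proof. by rewrite dotvDr -scaleN1r dotvZr mulN1r. Qed.

Lemma dotv0r u : dotv u 0 = 0.
Proof. by rewrite /dotv big1// => k _; rewrite mxE mulr0. Qed.

Lemma enorm2_ge0 u : 0 <= enorm2 u.
Proof. by apply: sumr_ge0 => k _; rewrite -expr2 sqr_ge0. Qed.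

Lemma sqr_coord_le_enorm2 u (k : 'I_m) : u ord0 k ^+ 2 <= enorm2 u.
Proof.
rewrite /enorm2 /dotv (bigD1 k)//= -expr2 lerDl.
by apply: sumr_ge0 => j _; rewrite -expr2 sqr_ge0.
Qed.

Lemma dotv_norm_le u v : `|dotv u v| <= m%:R * (`|u| * `|v|).
Proof.
apply: le_trans (ler_norm_sum _ _ _) _.
apply: (@le_trans _ _ (\sum_(k < m) `|u| * `|v|)).
  by apply: ler_sum => k _; rewrite normrM ler_pM// coord_le_norm.
by rewrite sumr_const card_ord mulr_natl.
Qed.

Lemma enorm2BZ u v (l : R) :
  enorm2 (u - l *: v) = enorm2 u - 2 * l * dotv u v + l ^+ 2 * enorm2 v.
Proof.
rewrite /enorm2 dotvBr dotvZr dotvC dotvBr dotvZr.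
by rewrite [dotv (u - _) v]dotvC dotvBr dotvZr [dotv v u]dotvC; ring.
Qed.

Lemma proj_dotv_ge C x p z : convex_setR C -> is_proj C x p -> C z ->
  enorm2 (x - p) <= dotv (x - z) (x - p).
Proof.
move=> cC [Cp pmin] Cz.
(* The point [p] is compared with [p + l * (z - p)]; dividing by [l] and taking [l * N <= e] leaves
   an arbitrarily small bound. The 1 in [N + 1] covers [N = 0]. *)
have obtuse : dotv (x - p) (z - p) <= 0.
  apply/ler_addgt0Pl => e e0; rewrite addr0; pose N := enorm2 (z - p).
  have N0 : 0 <= N by exact: enorm2_ge0.
  pose l := Num.min 1 (e / (N + 1)).
  have N1 : 0 < N + 1 by lra.
  have l0 : 0 < l by rewrite lt_min ltr01 divr_gt0.
  have l1 : l <= 1 by rewrite ge_min lexx.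
  have lN : l * N <= e.
    have : l <= e / (N + 1) by rewrite ge_min lexx orbT.
    by rewrite ler_pdivlMr// mulrDr; lra.
  have l01 : 0 <= l <= 1 by rewrite ltW.
  have := pmin _ (cC z p l Cz Cp l01).
  rewrite (_ : x - (l *: z + (1 - l) *: p) = (x - p) - l *: (z - p)); last first.
    by apply/matrixP => i j; rewrite !mxE; ring.
  rewrite enorm2BZ -/N => H.
  have {}H : l * (2 * dotv (x - p) (z - p)) <= l * (l * N) by lra.
  by rewrite ler_pM2l// in H; lra.
rewrite (_ : x - z = (x - p) - (z - p)); last first.
  by apply/matrixP => i j; rewrite !mxE; ring.
rewrite dotvC dotvBr -/(enorm2 _); lra.
Qed.

(** Where [g x > 0], this is the subgradient inequality tested at [z], with [g z] bounded by 0. *)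
Lemma grad_plus_dotv_ge (g : 'rV[R]_m -> R) (G : 'rV[R]_m -> 'rV[R]_m) x z :
  is_grad_plus g G -> g z <= 0 -> Num.max 0 (g x) <= dotv (x - z) (G x).
Proof.
move=> gG gz; have [G0 Gsub] := gG x; case: (leP (g x) 0) => gx.
  by rewrite G0// dotv0r.
have := Gsub gx z; rewrite (_ : z - x = (-1) *: (x - z)); last first.
  by apply/matrixP => i j; rewrite !mxE; ring.
rewrite dotvZr dotvC; lra.
Qed.

(** * Limits and cluster points at infinity *)

Lemma cvg_pinfty_norm_le (u : R -> 'rV[R]_m) (l : 'rV[R]_m) :
  u t @[t --> +oo] --> l -> forall e, 0 < e ->
  exists t0 : R, 0 <= t0 /\ forall t, t0 <= t -> `|u t - l| <= e.
Proof.
move=> /cvgrPdist_le H e e0; have [M [_ HM]] := H e e0.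
exists (Num.max 0 M + 1); split; first by rewrite addr_ge0// le_max lexx.
move=> t Mt; rewrite distrC; apply: HM.
by have : M <= Num.max 0 M by [rewrite le_max lexx orbT]; lra.
Qed.

Lemma norm_le_cvg_pinfty (u : R -> 'rV[R]_m) (l : 'rV[R]_m) :
  (forall e, 0 < e -> exists t0 : R, forall t, t0 <= t -> `|u t - l| <= e) ->
  u t @[t --> +oo] --> l.
Proof.
move=> H; apply/cvgrPdist_le => e e0; have [t0 Ht0] := H e e0.
exists t0; split; first exact: num_real.
by move=> t tt; rewrite distrC; apply: Ht0; exact: ltW.
Qed.

(** Closed balls are compact in finite dimension; [l] is a cluster point of the image under [u] of
    the filter at infinity. *)
Lemma bounded_pinfty_cluster (u : R -> 'rV[R]_m) (M : R) :
  (forall t, 0 <= t -> `|u t| <= M) ->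
  exists l, forall e t0, 0 < e -> exists t, t0 <= t /\ `|u t - l| <= e.
Proof.
move=> uM; have M1 : 0 < `|M| + 1 by rewrite ltr_wpDl.
have K : compact (closed_ball (0 : 'rV[R]_m) (`|M| + 1)).
  apply: bounded_closed_compact; last exact: closed_ball_closed.
  rewrite closed_ballE//; exists (`|M| + 1); split; first exact: num_real.
  move=> N MN v; rewrite /closed_ball_/= sub0r normrN => vM.
  exact: le_trans vM (ltW MN).
have [|l [_ cl]] := K (u t @[t --> +oo]) _.
  exists 0; split; first exact: num_real.
  move=> t t0 /=; rewrite closed_ballE//= /closed_ball_/= sub0r normrN.
  by apply: le_trans (uM t (ltW t0)) _; have := ler_norm M; lra.
exists l => e t0 e0.
have FA : (u t @[t --> +oo]) [set u t | t in [set t | t0 <= t]].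
  exists t0; split; first exact: num_real.
  by move=> t tt /=; exists t => //=; exact: ltW.
have [_ [[t /= t0t <-]]] := cl _ _ FA (nbhsx_ballx l e e0).
rewrite -ball_normE/= => /ltW ute.
by exists t; split => //; rewrite distrC.
Qed.

End RowVectors.

(** Past a time where [U] is within [e] of its supremum, monotonicity leaves room only for
    increments of at most [e]. *)
Lemma bounded_increments_vanish (R : realType) (U : R -> R) (M T : R) : 0 <= T ->
  (forall s t, 0 <= s -> s <= t -> U s <= U t) -> (forall t, 0 <= t -> U t <= M) ->
  forall e, 0 < e -> exists t0, 0 <= t0 /\
    forall t, t0 <= t -> U (t + T) - U t <= e.
Proof.
move=> T0 Umon UM e e0; pose S := [set U t | t in [set t | 0 <= t]].
have hS : has_sup S.
  by split; [exists (U 0), 0 => /=|exists M => _ [t /= t0 <-]; exact: UM].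
have [_ [t0 /= t00 <-] Ut0] := sup_adherent e0 hS.
exists t0; split => // t t0t; have t_ge0 := le_trans t00 t0t.
have : U (t + T) <= sup S.
  by apply: sup_upper_bound => //; exists (t + T) => //=; rewrite addr_ge0.
have := Umon _ _ t00 t0t; lra.
Qed.

(** * The dynamics *)

Lemma uniformly_eventually (R : realType) (I : finType) (Q : I -> R -> Prop) :
  (forall i, exists t0 : R, 0 <= t0 /\ forall t, t0 <= t -> Q i t) ->
  exists t0 : R, 0 <= t0 /\ forall t, t0 <= t -> forall i, Q i t.
Proof.
move=> /choice[t0 Ht0]; exists (\sum_i t0 i); split.
  by apply: sumr_ge0 => i _; have [] := Ht0 i.
move=> t tt i; apply: (proj2 (Ht0 i)); apply: le_trans tt.
by rewrite (bigD1 i)//= lerDl; apply: sumr_ge0 => j _; have [] := Ht0 j.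
Qed.

Section Dynamics.
Variables (R : realType) (n m : nat).
Variables (g : 'I_n -> 'rV[R]_m -> R) (X : 'I_n -> set 'rV[R]_m).
Variables (P G : 'I_n -> 'rV[R]_m -> 'rV[R]_m).
Variables (a : 'I_n -> 'I_n -> R -> R) (tau delta T : R).
Variables (x phi f : 'I_n -> R -> 'rV[R]_m).
Hypothesis g_continuous : forall i, continuous (g i).
Hypothesis X_closed : forall i, closed (X i).
Hypothesis X_convex : forall i, convex_setR (X i).
Hypothesis P_proj : forall i y, is_proj (X i) y (P i y).
Hypothesis G_grad : forall i, is_grad_plus (g i) (G i).
Hypothesis a_ge0 : forall i j t, 0 <= t -> 0 <= a i j t.
Hypothesis a_bal : balanced a.
Hypothesis a_conn : strongly_connected (delta_edge a delta T).
Hypotheses (delta_gt0 : 0 < delta) (T_gt0 : 0 < T) (tau_gt0 : 0 < tau).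
Hypothesis phiE : forall i t,
  phi i t = - tau *: ((x i t - P i (x i t)) + G i (x i t)).
Hypothesis fE : forall i t,
  f i t = \sum_j a i j t *: (x j t - x i t) + phi i t.
Hypothesis x_AC : forall i k, AC (fun t => x i t ord0 k) (fun t => f i t ord0 k).

Definition lyapunov (z : 'rV[R]_m) (t : R) : R :=
  \sum_k \sum_i (x i t ord0 k - z ord0 k) ^+ 2.

Definition dlyapunov (z : 'rV[R]_m) (t : R) : R :=
  \sum_k \sum_i 2 * (x i t ord0 k - z ord0 k) * f i t ord0 k.

Implicit Types (z : 'rV[R]_m) (s t e : R) (i j : 'I_n) (k : 'I_m).

Lemma f_coord i k t : f i t ord0 k =
  \sum_j a i j t * (x j t ord0 k - x i t ord0 k) + phi i t ord0 k.
Proof.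
by rewrite fE mxE summxE; congr (_ + _); apply: eq_bigr => j _; rewrite !mxE.
Qed.

Lemma lyapunov_AC z : AC (lyapunov z) (dlyapunov z).
Proof.
apply: (AC_sum (y := fun k t => \sum_i (x i t ord0 k - z ord0 k) ^+ 2)
  (f := fun k t => \sum_i 2 * (x i t ord0 k - z ord0 k) * f i t ord0 k)) => k.
apply: (AC_sum (y := fun i t => (x i t ord0 k - z ord0 k) ^+ 2)
  (f := fun i t => 2 * (x i t ord0 k - z ord0 k) * f i t ord0 k)) => i.
apply: (@AC_comp _ (fun u => (u - z ord0 k) ^+ 2) (fun u => 2 * (u - z ord0 k)) 1
  _ _ _ (x_AC i k)) => u v.
rewrite (_ : _ - _ - _ = (v - u) ^+ 2); last by ring.
by rewrite ger0_norm ?sqr_ge0// mul1r.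
Qed.

Lemma sqr_coord_le_lyapunov z t i k :
  (x i t ord0 k - z ord0 k) ^+ 2 <= lyapunov z t.
Proof.
rewrite /lyapunov (bigD1 k)//= (bigD1 i)//= -addrA lerDl addr_ge0//.
  by apply: sumr_ge0 => j _; rewrite sqr_ge0.
by apply: sumr_ge0 => l _; apply: sumr_ge0 => j _; rewrite sqr_ge0.
Qed.

Lemma lyapunov_ge0 z t : 0 <= lyapunov z t.
Proof. by do 2 apply: sumr_ge0 => ? _; rewrite sqr_ge0. Qed.

(** The sum of the projection and subgradient inequalities. Its sign yields dissipation, and with
    [phi] small it forces near-feasibility. *)
Lemma residual_le z i t : cfp_sol g X z ->
  enorm2 (x i t - P i (x i t)) + Num.max 0 (g i (x i t)) <=
  - (tau^-1 * dotv (x i t - z) (phi i t)).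
Proof.
move=> /(_ i)[gz Xz]; rewrite phiE dotvZr mulrA mulrN mulVf ?gt_eqF// mulN1r opprK.
rewrite dotvDr lerD//; first exact: proj_dotv_ge.
exact: grad_plus_dotv_ge.
Qed.

Lemma dissipation_le z t : cfp_sol g X z -> 0 <= t ->
  \sum_k \sum_i \sum_j a i j t * (x j t ord0 k - x i t ord0 k) ^+ 2 <=
  - dlyapunov z t.
Proof.
move=> zsol t0.
(* The derivative splits exactly into the disagreement term and the pairing with [phi]; the latter
   is nonpositive by [residual_le]. *)
have -> : dlyapunov z t =
    - (\sum_k \sum_i \sum_j a i j t * (x j t ord0 k - x i t ord0 k) ^+ 2)
    + 2 * \sum_i dotv (x i t - z) (phi i t).
  rewrite /dotv [X in 2 * X]exchange_big/= mulr_sumr -sumrN -big_split/=.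
  apply: eq_bigr => k _.
  have := @balanced_dissipation _ _ (fun i j => a i j t) (fun i => a_bal i t0)
    (fun i => x i t ord0 k - z ord0 k).
  rewrite (eq_bigr (fun i => 2 * (x i t ord0 k - z ord0 k) *
     \sum_j a i j t * (x j t ord0 k - x i t ord0 k))); last first.
    by move=> i _; congr (_ * _); apply: eq_bigr => j _; congr (_ * _); ring.
  move=> E.
  rewrite (_ : - (\sum_i _) = - (\sum_i \sum_j a i j t *
    (x j t ord0 k - z ord0 k - (x i t ord0 k - z ord0 k)) ^+ 2)); last first.
    congr (- _); apply: eq_bigr => i _; apply: eq_bigr => j _; congr (_ * _); ring.
  rewrite -E mulr_sumr -big_split/=; apply: eq_bigr => i _.
  by rewrite f_coord !mxE; ring.
have : \sum_i dotv (x i t - z) (phi i t) <= 0.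
  apply: sumr_le0 => i _.
  have := residual_le i t zsol; have := enorm2_ge0 (x i t - P i (x i t)).
  have : 0 <= Num.max 0 (g i (x i t)) by rewrite le_max lexx.
  move=> h1 h2 h3; have : 0 <= - (tau^-1 * dotv (x i t - z) (phi i t)) by lra.
  by rewrite oppr_ge0 pmulr_rle0// invr_gt0.
lra.
Qed.

Lemma coord_dissipation_le z t k : cfp_sol g X z -> 0 <= t ->
  \sum_i \sum_j a i j t * (x j t ord0 k - x i t ord0 k) ^+ 2 <= - dlyapunov z t.
Proof.
move=> zsol t0; apply: le_trans (dissipation_le zsol t0).
rewrite [leRHS](bigD1 k)//= lerDl.
by do 3 (apply: sumr_ge0 => ? _); rewrite mulr_ge0 ?a_ge0 ?sqr_ge0.
Qed.

Lemma lyapunov_nincr z s t : cfp_sol g X z -> 0 <= s -> s <= t ->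
  lyapunov z t <= lyapunov z s.
Proof.
move=> zsol s0 st; rewrite -lerN2.
have := AC_ge0 (AC_scale (-1) (lyapunov_AC z)) s0 st; rewrite !mulN1r; apply.
move=> r sr _; rewrite mulN1r; have r0 := le_trans s0 sr.
apply: le_trans (dissipation_le zsol r0).
by do 3 (apply: sumr_ge0 => ? _); rewrite mulr_ge0 ?a_ge0 ?sqr_ge0.
Qed.

(** For each coordinate [u] of the difference, [u ^+ 2 <= M] gives [|u| <= M + 1], which spares a
    square root. *)
Lemma trajectory_bounded z i t : cfp_sol g X z -> 0 <= t ->
  `|x i t - z| <= lyapunov z 0 + 1.
Proof.
move=> zsol t0; have V0 := lyapunov_ge0 z 0.
apply: norm_le_coord => [|k]; first lra.
have := le_trans (sqr_coord_le_lyapunov z t i k) (lyapunov_nincr zsol (lexx 0) t0).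
rewrite !mxE; set u := x i t _ _ - _; set M := lyapunov z 0 => uM.
have := real_normK (num_real u) => uE; rewrite -uE in uM.
have := normr_ge0 u; nra.
Qed.

(** * Consensus and convergence of the trajectories *)

Hypothesis phi_cvg : forall i, phi i t @[t --> +oo] --> (0 : 'rV[R]_m).

Lemma phi_small e : 0 < e ->
  exists t0, 0 <= t0 /\ forall t, t0 <= t -> forall i, `|phi i t| <= e.
Proof.
move=> e0; apply: (uniformly_eventually (Q := fun i t => `|phi i t| <= e)) => i.
have [t0 [t00 Ht0]] := cvg_pinfty_norm_le (phi_cvg i) e0.
by exists t0; split => // t /Ht0; rewrite subr0.
Qed.

Lemma consensus z e : cfp_sol g X z -> 0 < e ->
  exists t0, 0 <= t0 /\ forall t, t0 <= t -> forall i j, `|x i t - x j t| <= e.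
Proof.
move=> zsol e0.
have [n0|n_gt0] := posnP n.
  exists 0; split => // t _ i; exfalso.
  by have := leq_ltn_trans (leq0n i) (ltn_ord i); rewrite n0.
have n1 : 1 <= n%:R :> R by rewrite ler1n.
(* This makes the spread bound [n * (3 * h)] equal to [e]. *)
pose h := e / (3 * n%:R).
have h0 : 0 < h by rewrite divr_gt0//; lra.
have hE : n%:R * (3 * h) = e by rewrite /h; field; lra.
have hh : 0 < h ^+ 2 by rewrite exprn_gt0.
(* With [eps] below, [8 * kappa <= h ^+ 2 / 4] and [2 * h * n * eps * T = h ^+ 2 / 2] add up to less
   than [h ^+ 2]; the second entry ensures [kappa < h ^+ 2 * delta]. *)
pose kappa := Num.min (h ^+ 2 / 32) (h ^+ 2 * delta / 2).
have hd : 0 < h ^+ 2 * delta by rewrite mulr_gt0.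
have kappa0 : 0 < kappa by rewrite lt_min; apply/andP; split; lra.
have nT : 0 < n%:R * T by rewrite mulr_gt0//; lra.
pose eps := h / (4 * (n%:R * T)).
have eps0 : 0 < eps by rewrite divr_gt0//; lra.
have UAC := AC_scale (-1) (lyapunov_AC z).
have [| | |t1 [t10 Ht1]] := @bounded_increments_vanish _
    (fun t => -1 * lyapunov z t) 0 T _ _ _ kappa kappa0.
- exact: ltW.
- by move=> s t s0 st; have := lyapunov_nincr zsol s0 st; lra.
- by move=> t _; have := lyapunov_ge0 z t; lra.
have [t2 [t20 Ht2]] := phi_small eps0.
exists (t1 + t2); split; first exact: addr_ge0.
move=> t tt.
have key k i j : x i t ord0 k - x j t ord0 k < e.
  rewrite -hE.
  apply: (@window_spread _ _ a delta T (fun i t => x i t ord0 k)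
    (fun i t => f i t ord0 k) (fun i t => phi i t ord0 k)
    (fun t => -1 * lyapunov z t) (fun t => -1 * dlyapunov z t) t h eps kappa) => //.
  - exact: ltW.
  - lra.
  - by move=> i' s _; exact: f_coord.
  - by move=> s s0; rewrite mulN1r; exact: coord_dissipation_le.
  - move=> i' s ts; apply: le_trans (coord_le_norm _ _) _; apply: Ht2; lra.
  - apply: Ht1; lra.
  - have : kappa <= h ^+ 2 / 32 by rewrite ge_min lexx.
    rewrite (_ : 2 * h * n%:R * eps * T = h ^+ 2 / 2); first lra.
    have Tn0 : T != 0 by rewrite gt_eqF.
    have nn0 : n%:R != 0 :> R by rewrite gt_eqF//; lra.
    by rewrite /eps; field; rewrite Tn0 nn0.
  - have : kappa <= h ^+ 2 * delta / 2 by rewrite ge_min lexx orbT.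
    lra.
move=> i j; apply: norm_le_coord => [|k]; first exact: ltW.
rewrite !mxE ler_norml; have := key k i j; have := key k j i.
by move=> ? ?; apply/andP; split; lra.
Qed.

Lemma residual_small z e : cfp_sol g X z -> 0 < e ->
  exists t0, 0 <= t0 /\ forall t, t0 <= t -> forall i,
    enorm2 (x i t - P i (x i t)) + Num.max 0 (g i (x i t)) <= e.
Proof.
move=> zsol e0; pose B := m%:R * (lyapunov z 0 + 1).
have B0 : 0 <= B by rewrite mulr_ge0// addr_ge0// lyapunov_ge0.
(* [B] bounds [m * |x i t - z|], so this threshold for [phi] bounds the residual by [e]. *)
have d0 : 0 < tau * e / (B + 1) by rewrite divr_gt0// ?mulr_gt0//; lra.
have [t0 [t00 Ht0]] := phi_small d0.
exists t0; split => // t tt i; apply: le_trans (residual_le i t zsol) _.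
rewrite -mulrN ler_pdivrMl//.
apply: le_trans (ler_norm _) _; rewrite normrN.
apply: le_trans (dotv_norm_le _ _) _; rewrite mulrA.
apply: (@le_trans _ _ (B * (tau * e / (B + 1)))).
  apply: ler_pM => //.
    rewrite ler_wpM2l//; apply: trajectory_bounded => //; exact: le_trans tt.
  exact: Ht0.
rewrite mulrA ler_pdivrMr; last lra.
have : 0 < tau * e by rewrite mulr_gt0.
nra.
Qed.

Lemma frequently_near_sol z : (0 < n)%N -> cfp_sol g X z ->
  exists2 xs, cfp_sol g X xs &
    forall e t0, 0 < e -> exists t, t0 <= t /\ forall i, `|x i t - xs| <= e.
Proof.
move=> n0 zsol; pose i0 : 'I_n := Ordinal n0.
have [|xs Hxs] := @bounded_pinfty_cluster _ _ (x i0) (lyapunov z 0 + 1 + `|z|).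
  move=> t t0; have := trajectory_bounded i0 zsol t0.
  have := ler_normD (x i0 t - z) z; rewrite subrK; lra.
(* Agent [i0] returns near [xs] at arbitrarily late times, and consensus brings the others along. *)
have near e t0 : 0 < e -> exists t, t0 <= t /\ forall i, `|x i t - xs| <= e.
  move=> e0; have e2 : 0 < e / 2 by rewrite divr_gt0.
  have [t1 [_ Ht1]] := consensus zsol e2.
  have [t [tt xt]] := Hxs (e / 2) (Num.max t0 t1) e2.
  move: tt; rewrite ge_max => /andP[t0t t1t]; exists t; split => // i.
  have := Ht1 t t1t i i0; have := ler_distD (x i0 t) (x i t) xs; lra.
exists xs => // i; split.
  (* If [g i xs > 0], continuity keeps [g i] at three quarters of that value or more near [xs],
     whereas the residual is at most a quarter of it. *)
  rewrite leNgt; apply/negP => gxs.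
  have g4 : 0 < g i xs / 4 by rewrite divr_gt0.
  have [t0 [_ Ht0]] := residual_small zsol g4.
  have /cvgrPdist_le/(_ _ g4) := @g_continuous i xs.
  move=> /nbhs_ballP[r /= r0 Hr].
  have r2 : 0 < r / 2 by rewrite divr_gt0.
  have [t [t0t xt]] := near (r / 2) t0 r2.
  have /= := Hr (x i t) _; rewrite -ball_normE/= distrC.
  have xr : `|x i t - xs| < r by have := xt i; lra.
  move=> /(_ xr); rewrite ler_norml => /andP[_ h1].
  have := Ht0 t t0t i; have := enorm2_ge0 (x i t - P i (x i t)).
  have : g i (x i t) <= Num.max 0 (g i (x i t)) by rewrite le_max lexx orbT.
  lra.
(* The projections [P i (x i t)] are points of [X i] within [r / 2] of [xs]. *)
apply: X_closed => B /nbhs_ballP[r /= r0 Hr].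
have r2 : 0 < r / 4 by rewrite divr_gt0.
have r22 : 0 < (r / 4) ^+ 2 by rewrite exprn_gt0.
have [t0 [_ Ht0]] := residual_small zsol r22.
have [t [t0t xt]] := near (r / 4) t0 r2.
exists (P i (x i t)); split; first by have [] := P_proj i (x i t).
apply: Hr; rewrite -ball_normE/=.
have : `|x i t - P i (x i t)| <= r / 4.
  apply: norm_le_coord => [|k]; first exact: ltW.
  have := sqr_coord_le_enorm2 (x i t - P i (x i t)) k.
  have := Ht0 t t0t i.
  have : 0 <= Num.max 0 (g i (x i t)) by rewrite le_max lexx.
  set u := (_ - _ : 'rV[R]_m) ord0 k => h1 h2 h3.
  have r4 := ltW r2; rewrite -ler_sqr ?nnegrE// real_normK ?num_real//; lra.
have := xt i; have := ler_distD (x i t) xs (P i (x i t)).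
rewrite (distrC xs (x i t)); lra.
Qed.

(** One time with all agents close to [xs] suffices, as the Lyapunov function centred at [xs] never
    increases. *)
Lemma limit_of_frequently_near xs : cfp_sol g X xs ->
  (forall e t0, 0 < e -> exists t, t0 <= t /\ forall i, `|x i t - xs| <= e) ->
  forall i, x i t @[t --> +oo] --> xs.
Proof.
move=> xsol near i; apply: norm_le_cvg_pinfty => e e0.
pose N : R := (m * n)%:R; have N0 : 0 <= N by [].
have N1 : 0 < N + 1 by lra.
have d0 : 0 < e / (N + 1) by rewrite divr_gt0.
have [t0 [t00 Ht0]] := near _ 0 d0; exists t0 => t tt.
(* The [m * n] squares are each at most [(e / (N + 1)) ^+ 2], and [N <= (N + 1) ^+ 2]. *)
have V0 : lyapunov xs t0 <= N * (e / (N + 1)) ^+ 2.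
  have -> : N * (e / (N + 1)) ^+ 2 = \sum_(k < m) \sum_(j < n) (e / (N + 1)) ^+ 2.
    by rewrite !sumr_const !card_ord -mulrnA -[RHS]mulr_natl mulnC.
  apply: ler_sum => k _; apply: ler_sum => j _.
  have := le_trans (coord_le_norm (x j t0 - xs) k) (Ht0 j); rewrite !mxE => H.
  by rewrite -[leLHS]real_normK ?num_real// lerXn2r ?nnegrE// ltW.
have Ne : N * (e / (N + 1)) ^+ 2 <= e ^+ 2.
  rewrite exprMn mulrCA ler_piMr ?sqr_ge0// exprVn ler_pdivrMr ?exprn_gt0//; nra.
apply: norm_le_coord => [|k]; first exact: ltW.
have := le_trans (sqr_coord_le_lyapunov xs t i k) (lyapunov_nincr xsol t00 tt).
rewrite !mxE => h1.
have e_ge0 := ltW e0; rewrite -ler_sqr ?nnegrE// real_normK ?num_real//; lra.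
Qed.

End Dynamics.

Theorem theorem4 (R : realType) (n m : nat)
  (g : 'I_n -> 'rV[R]_m -> R) (X : 'I_n -> set 'rV[R]_m)
  (P : 'I_n -> 'rV[R]_m -> 'rV[R]_m) (G : 'I_n -> 'rV[R]_m -> 'rV[R]_m)
  (a : 'I_n -> 'I_n -> R -> R) (tau delta T : R)
  (x : 'I_n -> R -> 'rV[R]_m) :
  (forall i, convex_fun (g i)) ->
  (forall i, continuous (g i)) ->
  (forall i, closed (X i)) ->
  (forall i, convex_setR (X i)) ->
  (forall i y, is_proj (X i) y (P i y)) ->
  (forall i, is_grad_plus (g i) (G i)) ->
  (forall i j t, 0 <= t -> 0 <= a i j t) ->
  (* (i) *) cfp_sol g X !=set0 ->
  (* (ii) *) balanced a ->
  (* (iii) *) 0 < delta -> 0 < T -> strongly_connected (delta_edge a delta T) ->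
  0 < tau ->
  let phi := fun (i : 'I_n) (t : R) =>
    (- tau *: ((x i t - P i (x i t)) + G i (x i t)) : 'rV[R]_m) in
  let rhs := fun (i : 'I_n) (t : R) =>
    (\sum_(j < n) a i j t *: (x j t - x i t) + phi i t : 'rV[R]_m) in
  (* x solves the dynamics (Caratheodory / integral form) on [0, oo) *)
  (forall i (k : 'I_m) (t : R), 0 <= t ->
     (@lebesgue_measure R).-integrable `[0, t] (fun s => ((rhs i s) ord0 k)%:E)
     /\ (x i t) ord0 k =
        (x i 0) ord0 k + Rintegral (@lebesgue_measure R) `[0, t]
                                   (fun s => (rhs i s) ord0 k)) ->
  (forall i, phi i t @[t --> +oo] --> (0 : 'rV[R]_m)) ->
  (forall i j, (x i t - x j t) @[t --> +oo] --> (0 : 'rV[R]_m)) /\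
  exists2 xs, cfp_sol g X xs & forall i, x i t @[t --> +oo] --> xs.
Proof.
move=> g_convex g_cont X_closed X_convex P_proj G_grad a_ge0 [z zsol] a_bal
  delta0 T0 conn tau0 phi f x_sol phi_cvg.
have phiE i t : phi i t = - tau *: ((x i t - P i (x i t)) + G i (x i t)) by [].
have fE i t : f i t = \sum_j a i j t *: (x j t - x i t) + phi i t by [].
have x_AC i k : AC (fun t => x i t ord0 k) (fun t => f i t ord0 k).
  by move=> t /(x_sol i k t).
split.
  move=> i j; apply: norm_le_cvg_pinfty => e e0.
  have [t0 [_ H]] := consensus X_convex P_proj G_grad a_ge0 a_bal conn delta0 T0
    tau0 phiE fE x_AC phi_cvg zsol e0.
  by exists t0 => t /H; rewrite subr0.
(* Without agents the given [z] serves, as claims about each agent are vacuous. *)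
have [n0|n_gt0] := posnP n.
  exists z => // i; exfalso.
  by have := leq_ltn_trans (leq0n i) (ltn_ord i); rewrite n0.
have [xs xsol near] := frequently_near_sol g_cont X_closed X_convex P_proj G_grad
  a_ge0 a_bal conn delta0 T0 tau0 phiE fE x_AC phi_cvg n_gt0 zsol.
exists xs => // i.
exact: (limit_of_frequently_near X_convex P_proj G_grad a_ge0 a_bal tau0 phiE fE
  x_AC xsol near).
Qed.
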